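(* The Lie algebra $\mathcal O$ has a presentation by generators $$\lbrace\mathcal W_{-k}\rbrace_{k\in\mathbb N},\quad \lbrace\mathcal W_{k+1}\rbrace_{k\in\mathbb N},\quad \lbrace\mathcal G_{k+1}\rbrace_{k\in\mathbb N},\quad \lbrace\tilde{\mathcal G}_{k+1}\rbrace_{k\in\mathbb N}$$ and the following relations. For $k,\ell\in\mathbb N$, \begin{align*} &[\mathcal W_0,\mathcal W_{k+1}]=[\mathcal W_{-k},\mathcal W_1]=(\tilde{\mathcal G}_{k+1}-\mathcal G_{k+1})/2,\\ &[\mathcal W_0,\mathcal G_{k+1}]=[\tilde{\mathcal G}_{k+1},\mathcal W_0]=4\mathcal W_{-k-1}-4\mathcal W_{k+1},\\ &[\mathcal G_{k+1},\mathcal W_1]=[\mathcal W_1,\tilde{\mathcal G}_{k+1}]=4\mathcal W_{k+2}-4\mathcal W_{-k},\\ &[\mathcal W_{-k},\mathcal W_{-\ell}]=0,\qquad [\mathcal W_{k+1},\mathcal W_{\ell+1}]=0,\\ &[\mathcal W_{-k},\mathcal W_{\ell+1}]+[\mathcal W_{k+1},\mathcal W_{-\ell}]=0,\\ &[\mathcal W_{-k},\mathcal G_{\ell+1}]+[\mathcal G_{k+1},\mathcal W_{-\ell}]=0,\\ &[\mathcal W_{-k},\tilde{\mathcal G}_{\ell+1}]+[\tilde{\mathcal G}_{k+1},\mathcal W_{-\ell}]=0,\\ &[\mathcal W_{k+1},\mathcal G_{\ell+1}]+[\mathcal G_{k+1},\mathcal W_{\ell+1}]=0,\\ &[\mathcal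 W_{k+1},\tilde{\mathcal G}_{\ell+1}]+[\tilde{\mathcal G}_{k+1},\mathcal W_{\ell+1}]=0,\\ &[\mathcal G_{k+1},\mathcal G_{\ell+1}]=0,\qquad [\tilde{\mathcal G}_{k+1},\tilde{\mathcal G}_{\ell+1}]=0,\\ &[\tilde{\mathcal G}_{k+1},\mathcal G_{\ell+1}]+[\mathcal G_{k+1},\tilde{\mathcal G}_{\ell+1}]=0. \end{align*}
   Context: $\mathbb F$ is a field of characteristic zero; all vector spaces and Lie algebras are over $\mathbb F$. $\mathbb N=\{0,1,2,\ldots\}$. $\mathbb F[t,t^{-1}]$ is the algebra of Laurent polynomials. $L(\mathfrak{gl}_2)=\mathfrak{gl}_2\otimes\mathbb F[t,t^{-1}]$ is the loop algebra, with Lie bracket $[u\otimes\varphi,v\otimes\phi]=[u,v]\otimes\varphi\phi$; its elements are viewed as $2\times 2$ matrices with entries in $\mathbb F[t,t^{-1}]$, with bracket $[x,y]=xy-yx$. For $x=\begin{pmatrix} a(t)&b(t)\\ c(t)&d(t)\end{pmatrix}\in L(\mathfrak{gl}_2)$ define $\theta(x)=\begin{pmatrix} d(t^{-1})&c(t^{-1})\\ b(t^{-1})&a(t^{-1})\end{pmatrix}$ and $\varepsilon(x)=a(1)+d(1)\in\mathbb F$. Then $\theta$ is a Lie algebra automorphism of $L(\mathfrak{gl}_2)$ and $\varepsilon:L(\mathfrak{gl}_2)\to\mathbb F$ is a Lie algebra homomorphism ($\mathbb F$ abelian). Let $\mathcal L=\ker\varepsilon$, and let $\mathcal O$ be the Lie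 algebra of all elements of $\mathcal L$ fixed by $\theta$. In $\mathcal O$ define, for $k\in\mathbb N$, \begin{align*} &\mathcal W_{-k}=\Bigl(\tfrac{t+t^{-1}}{2}\Bigr)^k\begin{pmatrix}0&1\\1&0\end{pmatrix},\qquad \mathcal W_{k+1}=\Bigl(\tfrac{t+t^{-1}}{2}\Bigr)^k\begin{pmatrix}0&t\\t^{-1}&0\end{pmatrix},\\ &\mathcal G_{k+1}=\Bigl(\tfrac{t+t^{-1}}{2}\Bigr)^k\begin{pmatrix}2t-2&0\\0&2t^{-1}-2\end{pmatrix},\qquad \tilde{\mathcal G}_{k+1}=\Bigl(\tfrac{t+t^{-1}}{2}\Bigr)^k\begin{pmatrix}2t^{-1}-2&0\\0&2t-2\end{pmatrix}. \end{align*} ''$\mathcal O$ has a presentation by given generators and relations'' means: the Lie algebra over $\mathbb F$ defined abstractly by these generators and relations is isomorphic to $\mathcal O$ via the Lie algebra homomorphism sending each abstract generator to the element of $\mathcal O$ with the same name. *)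

(* Defs.v *)
From HB Require Import structures.
From mathcomp Require Import all_boot all_order all_algebra.
From mathcomp Require Import generic_quotient finmap monalg.
From mathcomp Require Import boolp ring.

Set Implicit Arguments.
Unset Strict Implicit.
Unset Printing Implicit Defensive.

Import GRing.Theory.

Local Open Scope ring_scope.
Local Open Scope quotient_scope.

HB.mixin Record Lmodule_isLieAlgebra (F : fieldType) L of GRing.Lmodule F L := {
  lieb : L -> L -> L;
  lieb_linear_l : forall (a : F) (x y z : L),
    lieb (a *: x + y) z = a *: lieb x z + lieb y z;
  lieb_linear_r : forall (a : F) (x y z : L),
    lieb x (a *: y + z) = a *: lieb x y + lieb x z;
  liebxx : forall x : L, lieb x x = 0;
  lieb_jacobi : forall x y z : L,
    lieb x (lieb y z) + lieb y (lieb z x) + lieb z (lieb x y) = 0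
}.

#[short(type="lieAlgType")]
HB.structure Definition LieAlgebra (F : fieldType) :=
  {L of GRing.Lmodule F L & Lmodule_isLieAlgebra F L}.

Reserved Notation "[ 'lie' x , y ]" (at level 0, format "[ 'lie'  x ,  y ]").
Notation "[ 'lie' x , y ]" := (lieb x y) : ring_scope.

Definition lie_morphism (F : fieldType) (L L' : lieAlgType F) (f : L -> L') :=
  linear f /\ forall x y : L, f [lie x, y] = [lie f x, f y].

Inductive lie_term (F : fieldType) (X : Type) : Type :=
| LGen of X
| LZero
| LAdd of lie_term F X & lie_term F X
| LOpp of lie_term F X
| LScale of F & lie_term F X
| LBracket of lie_term F X & lie_term F X.

Arguments LGen {F X}.
Arguments LZero {F X}.

Declare Scope lie_term_scope.
Delimit Scope lie_term_scope with lt.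
Bind Scope lie_term_scope with lie_term.
Notation "0" := LZero : lie_term_scope.
Notation "x + y" := (LAdd x y) : lie_term_scope.
Notation "- x" := (LOpp x) : lie_term_scope.
Notation "x - y" := (LAdd x (LOpp y)) : lie_term_scope.
Notation "a *: x" := (LScale a x) : lie_term_scope.
Notation "[ 'lie' x , y ]" := (LBracket x y) : lie_term_scope.

Section Presentation.
Context (F : fieldType) (X : Type) (R : lie_term F X -> lie_term F X -> Prop).
Local Notation term := (lie_term F X).

(* The least congruence containing the Lie algebra axioms and R. *)
Inductive lie_congr : term -> term -> Prop :=
| lc_rel x y : R x y -> lie_congr x y
| lc_refl x : lie_congr x x
| lc_sym x y : lie_congr x y -> lie_congr y x
| lc_trans x y z : lie_congr x y -> lie_congr y z -> lie_congr x z
| lc_add x x' y y' :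
    lie_congr x x' -> lie_congr y y' -> lie_congr (x + y) (x' + y')
| lc_opp x x' : lie_congr x x' -> lie_congr (- x) (- x')
| lc_scale a x x' : lie_congr x x' -> lie_congr (a *: x) (a *: x')
| lc_bracket x x' y y' :
    lie_congr x x' -> lie_congr y y' -> lie_congr [lie x, y] [lie x', y']
| lc_addA x y z : lie_congr (x + (y + z)) (x + y + z)
| lc_addC x y : lie_congr (x + y) (y + x)
| lc_add0 x : lie_congr (0 + x) x
| lc_addN x : lie_congr (- x + x) 0
| lc_scaleA a b x : lie_congr (a *: (b *: x)) ((a * b)%R *: x)
| lc_scale1 x : lie_congr (1%R *: x) x
| lc_scaleDr a x y : lie_congr (a *: (x + y)) (a *: x + a *: y)
| lc_scaleDl x a b : lie_congr ((a + b)%R *: x) (a *: x + b *: x)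
| lc_linear_l a x y z :
    lie_congr [lie a *: x + y, z] (a *: [lie x, z] + [lie y, z])
| lc_linear_r a x y z :
    lie_congr [lie x, a *: y + z] (a *: [lie x, y] + [lie x, z])
| lc_alt x : lie_congr [lie x, x] 0
| lc_jacobi x y z :
    lie_congr ([lie x, [lie y, z]] + [lie y, [lie z, x]] + [lie z, [lie x, y]])
              0.

HB.instance Definition _ := gen_eqMixin term.
HB.instance Definition _ := gen_choiceMixin term.

Definition lie_congrb : rel term := fun x y => `[< lie_congr x y >].

Lemma lie_congrb_refl : reflexive lie_congrb.
Proof. by move=> x; apply/asboolP/lc_refl. Qed.

Lemma lie_congrb_sym : symmetric lie_congrb.
Proof. by move=> x y; apply/asboolP/asboolP => /lc_sym. Qed.

Lemma lie_congrb_trans : transitive lie_congrb.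
Proof.
by move=> y x z /asboolP xy /asboolP yz; apply/asboolP; exact: lc_trans xy yz.
Qed.

Canonical lie_congr_equiv :=
  EquivRel lie_congrb lie_congrb_refl lie_congrb_sym lie_congrb_trans.

Definition presented : Type := {eq_quot lie_congr_equiv}.
HB.instance Definition _ := Choice.on presented.

Definition pres_pi (x : term) : presented := \pi_({eq_quot lie_congr_equiv}) x.
Definition pres_repr (u : presented) : term := repr (u : {eq_quot lie_congr_equiv}).

Lemma pres_reprK u : pres_pi (pres_repr u) = u.
Proof. exact: reprK. Qed.

Lemma pres_piP x y : pres_pi x = pres_pi y <-> lie_congr x y.
Proof.
split=> [/eqP|xy]; first by rewrite eqmodE => /asboolP.
by apply/eqP; rewrite eqmodE; apply/asboolP.
Qed.

Definition pres_add u v := pres_pi (pres_repr u + pres_repr v)%lt.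
Definition pres_opp u := pres_pi (- pres_repr u)%lt.
Definition pres_scale a u := pres_pi (a *: pres_repr u)%lt.
Definition pres_bracket u v := pres_pi [lie pres_repr u, pres_repr v]%lt.

Lemma pres_repr_pi x : lie_congr (pres_repr (pres_pi x)) x.
Proof. by apply/pres_piP; rewrite pres_reprK. Qed.

Lemma pres_add_pi x y : pres_add (pres_pi x) (pres_pi y) = pres_pi (x + y)%lt.
Proof. by apply/pres_piP/lc_add; exact: pres_repr_pi. Qed.

Lemma pres_opp_pi x : pres_opp (pres_pi x) = pres_pi (- x)%lt.
Proof. by apply/pres_piP/lc_opp; exact: pres_repr_pi. Qed.

Lemma pres_scale_pi a x : pres_scale a (pres_pi x) = pres_pi (a *: x)%lt.
Proof. by apply/pres_piP/lc_scale; exact: pres_repr_pi. Qed.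

Lemma pres_bracket_pi x y :
  pres_bracket (pres_pi x) (pres_pi y) = pres_pi [lie x, y]%lt.
Proof. by apply/pres_piP/lc_bracket; exact: pres_repr_pi. Qed.

Let piE := (pres_add_pi, pres_opp_pi, pres_scale_pi, pres_bracket_pi).

Lemma pres_ind (P : presented -> Prop) :
  (forall x, P (pres_pi x)) -> forall u, P u.
Proof. by move=> Ppi u; rewrite -[u]pres_reprK. Qed.

Lemma pres_addA : associative pres_add.
Proof.
elim/pres_ind=> x; elim/pres_ind=> y; elim/pres_ind=> z.
by rewrite !piE; apply/pres_piP/lc_addA.
Qed.

Lemma pres_addC : commutative pres_add.
Proof.
by elim/pres_ind=> x; elim/pres_ind=> y; rewrite !piE; apply/pres_piP/lc_addC.
Qed.

Lemma pres_add0 : left_id (pres_pi 0) pres_add.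
Proof. by elim/pres_ind=> x; rewrite !piE; apply/pres_piP/lc_add0. Qed.

Lemma pres_addN : left_inverse (pres_pi 0) pres_opp pres_add.
Proof. by elim/pres_ind=> x; rewrite !piE; apply/pres_piP/lc_addN. Qed.

HB.instance Definition _ := GRing.isZmodule.Build presented
  pres_addA pres_addC pres_add0 pres_addN.

Lemma pres_scaleA a b u : pres_scale a (pres_scale b u) = pres_scale (a * b) u.
Proof. by elim/pres_ind: u => x; rewrite !piE; apply/pres_piP/lc_scaleA. Qed.

Lemma pres_scale1 : left_id 1 pres_scale.
Proof. by elim/pres_ind=> x; rewrite !piE; apply/pres_piP/lc_scale1. Qed.

Lemma pres_scaleDr : right_distributive pres_scale +%R.
Proof.
move=> a; elim/pres_ind=> x; elim/pres_ind=> y.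
by rewrite /GRing.add /= !piE; apply/pres_piP/lc_scaleDr.
Qed.

Lemma pres_scaleDl u : {morph pres_scale^~ u : a b / a + b}.
Proof.
elim/pres_ind: u => x a b.
by rewrite [in RHS]/GRing.add /= !piE; apply/pres_piP/lc_scaleDl.
Qed.

HB.instance Definition _ := GRing.Zmodule_isLmodule.Build F presented
  pres_scaleA pres_scale1 pres_scaleDr pres_scaleDl.

Lemma pres_piD x y : pres_pi (x + y)%lt = pres_pi x + pres_pi y.
Proof. by rewrite -pres_add_pi. Qed.

Lemma pres_piZ a x : pres_pi (a *: x)%lt = a *: pres_pi x.
Proof. by rewrite -pres_scale_pi. Qed.

Lemma pres_linear_l a u v w : pres_bracket (a *: u + v) w =
  a *: pres_bracket u w + pres_bracket v w.
Proof.
elim/pres_ind: u => x; elim/pres_ind: v => y; elim/pres_ind: w => z.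
rewrite -pres_piZ -pres_piD !piE -pres_piZ -pres_piD.
exact/pres_piP/lc_linear_l.
Qed.

Lemma pres_linear_r a u v w : pres_bracket u (a *: v + w) =
  a *: pres_bracket u v + pres_bracket u w.
Proof.
elim/pres_ind: u => x; elim/pres_ind: v => y; elim/pres_ind: w => z.
rewrite -pres_piZ -pres_piD !piE -pres_piZ -pres_piD.
exact/pres_piP/lc_linear_r.
Qed.

Lemma pres_alt u : pres_bracket u u = 0.
Proof. by elim/pres_ind: u => x; rewrite !piE; apply/pres_piP/lc_alt. Qed.

Lemma pres_jacobi u v w :
  pres_bracket u (pres_bracket v w) + pres_bracket v (pres_bracket w u) +
  pres_bracket w (pres_bracket u v) = 0.
Proof.
elim/pres_ind: u => x; elim/pres_ind: v => y; elim/pres_ind: w => z.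
by rewrite !piE -!pres_piD; apply/pres_piP/lc_jacobi.
Qed.

HB.instance Definition _ := Lmodule_isLieAlgebra.Build F presented
  pres_linear_l pres_linear_r pres_alt pres_jacobi.

Definition pres_gen (g : X) : presented := pres_pi (LGen g).

Fixpoint lie_eval (L : lieAlgType F) (v : X -> L) (x : term) : L :=
  match x with
  | LGen g => v g
  | LZero => 0
  | LAdd x y => lie_eval v x + lie_eval v y
  | LOpp x => - lie_eval v x
  | LScale a x => a *: lie_eval v x
  | LBracket x y => [lie lie_eval v x, lie_eval v y]
  end.

Lemma lie_eval_pres_gen x : lie_eval pres_gen x = pres_pi x.
Proof.
elim: x => //= [x -> y ->|x ->|a x ->|x -> y ->].
- by rewrite -pres_add_pi.
- by rewrite -pres_opp_pi.
- by rewrite -pres_scale_pi.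
- by rewrite -pres_bracket_pi.
Qed.

Lemma lie_eval_congr (L : lieAlgType F) (v : X -> L) :
    (forall x y, R x y -> lie_eval v x = lie_eval v y) ->
  forall x y, lie_congr x y -> lie_eval v x = lie_eval v y.
Proof.
move=> vR x y; elim=> {x y} //=.
- by move=> x y z _ -> _ ->.
- by move=> x x' y y' _ -> _ ->.
- by move=> x x' _ ->.
- by move=> a x x' _ ->.
- by move=> x x' y y' _ -> _ ->.
- by move=> x y z; rewrite addrA.
- by move=> x y; rewrite addrC.
- by move=> x; rewrite add0r.
- by move=> x; rewrite addNr.
- by move=> a b x; rewrite scalerA.
- by move=> x; rewrite scale1r.
- by move=> a x y; rewrite scalerDr.
- by move=> x a b; rewrite scalerDl.
- by move=> a x y z; rewrite lieb_linear_l.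
- by move=> a x y z; rewrite lieb_linear_r.
- by move=> x; rewrite liebxx.
- by move=> x y z; rewrite lieb_jacobi.
Qed.

Lemma presented_universal (L : lieAlgType F) (v : X -> L) :
    (forall x y, R x y -> lie_eval v x = lie_eval v y) ->
  exists! f : presented -> L,
    lie_morphism f /\ forall g, f (pres_gen g) = v g.
Proof.
move=> vR; pose f u := lie_eval v (pres_repr u).
have f_pi x : f (pres_pi x) = lie_eval v x.
  exact/(lie_eval_congr vR)/pres_repr_pi.
exists f; split; first (split=> [|g]; last by rewrite f_pi).
  split=> [a|]; elim/pres_ind=> x; elim/pres_ind=> y.
    by rewrite -pres_piZ -pres_piD !f_pi.
  by rewrite /lieb /= !piE !f_pi.
move=> h [[h_lin h_br] h_gen]; apply/funext; elim/pres_ind=> x; rewrite f_pi.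
have hD u w : h (u + w) = h u + h w by rewrite -[u]scale1r h_lin !scale1r.
have h0 : h 0 = 0 by apply: (addrI (h 0)); rewrite -hD !addr0.
elim: x => /= [g||x -> y ->|x ->|a x ->|x -> y ->].
- by rewrite -h_gen.
- exact/esym/h0.
- by rewrite pres_piD hD.
- apply: (addrI (h (pres_pi x))); rewrite subrr -h0 -hD.
  by congr (h _); rewrite -pres_opp_pi subrr.
- by rewrite pres_piZ -[_ *: pres_pi x]addr0 h_lin h0 addr0.
- by rewrite -pres_bracket_pi h_br.
Qed.

End Presentation.

(* Finitely supported functions int -> F with the convolution product; the
   ring structure that monalg puts on {malg F[K]} is unavailable for K = int,
   whose zero is a sum of nonzero elements. *)
Definition laurent (F : fieldType) : Type := {malg F[int]}.

Section Laurent.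
Context (F : fieldType).

HB.instance Definition _ := GRing.Lmodule.copy (laurent F) {malg F[int]}.

Implicit Types p q r : laurent F.

Definition lmono (c : F) (i : int) : laurent F := << c *g i >>.

Section Lsum.
Context (V : zmodType) (phi : F -> int -> V).

Definition lsum p : V := \sum_(i <- msupp p) phi p@_i i.

Hypothesis phiD : forall i, {morph phi^~ i : c d / c + d}.

Let phi0 i : phi 0 i = 0.
Proof. by apply: (addrI (phi 0 i)); rewrite -phiD !addr0. Qed.

Lemma lsumEw (d : {fset int}) p :
  (msupp p `<=` d)%fset -> lsum p = \sum_(i <- d) phi p@_i i.
Proof.
by move=> le_pd; apply: big_fset_incl => // i _ /mcoeff_outdom ->.
Qed.

Lemma lsumD : {morph lsum : p q / p + q}.
Proof.
move=> p q; rewrite (lsumEw (msuppD_le p q)).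
rewrite (lsumEw (fsubsetUl (msupp p) (msupp q))).
rewrite (lsumEw (fsubsetUr (msupp p) (msupp q))) -big_split /=.
by apply: eq_bigr => i _; rewrite mcoeffD phiD.
Qed.

Lemma lsum_mono c i : lsum (lmono c i) = phi c i.
Proof. by rewrite (lsumEw msuppU_le) big_seq_fset1 mcoeffUU. Qed.

End Lsum.

Lemma lsum_morph (V W : zmodType) (phi : F -> int -> V) (psi : F -> int -> W)
    (h : V -> W) : {morph h : x y / x + y} ->
    (forall c i, h (phi c i) = psi c i) ->
  forall p, h (lsum phi p) = lsum psi p.
Proof.
move=> hD h_phi p; have h0 : h 0 = 0.
  by apply: (addrI (h 0)); rewrite -hD !addr0.
by rewrite /lsum (big_morph h hD h0); apply: eq_bigr.
Qed.

Lemma lmonoD i : {morph lmono^~ i : c d / c + d}.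
Proof. by move=> c d; rewrite /lmono monalgUD. Qed.

Lemma laurentE p : p = \sum_(i <- msupp p) lmono p@_i i.
Proof. exact: monalgE. Qed.

Lemma laurent_ind (P : laurent F -> Prop) :
    P 0 -> (forall p q, P p -> P q -> P (p + q)) ->
  (forall c i, P (lmono c i)) -> forall p, P p.
Proof. by move=> P0 PD Pm p; rewrite [p]laurentE; elim/big_ind: _. Qed.

Lemma lmono_scale a c i : a *: lmono c i = lmono (a * c) i.
Proof.
by apply/malgP => j; rewrite mcoeffZ !mcoeffU mulrnAr.
Qed.

Definition lmul p q : laurent F :=
  \sum_(i <- msupp p) \sum_(j <- msupp q) lmono (p@_i * q@_j) (i + j).

Definition lone : laurent F := lmono 1 0.

Let lmul_innerD c i j : {morph (fun d => lmono (c * d) (i + j)) : d e / d + e}.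
Proof. by move=> d e; rewrite mulrDr lmonoD. Qed.

Lemma lmulDr : right_distributive lmul +%R.
Proof.
move=> p q r; rewrite /lmul -big_split /=; apply: eq_bigr => i _.
exact: (lsumD (phi := fun d j => lmono (p@_i * d) (i + j))).
Qed.

Lemma lmulC : commutative lmul.
Proof.
move=> p q; rewrite /lmul exchange_big; apply: eq_bigr => i _.
by apply: eq_bigr => j _; rewrite mulrC addrC.
Qed.

Lemma lmulDl : left_distributive lmul +%R.
Proof. by move=> p q r; rewrite ![lmul _ r]lmulC lmulDr. Qed.

Lemma lmul0 p : lmul p 0 = 0.
Proof. by apply: (addrI (lmul p 0)); rewrite -lmulDr !addr0. Qed.

Lemma lmul_mono c d i j : lmul (lmono c i) (lmono d j) = lmono (c * d) (i + j).
Proof.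
pose phi (c : F) i := lsum (fun d j => lmono (c * d) (i + j)) (lmono d j).
have phiE c' i' : phi c' i' = lmono (c' * d) (i' + j).
  by rewrite /phi lsum_mono // => k x y; rewrite mulrDr lmonoD.
rewrite -phiE -[RHS](@lsum_mono _ phi) // => k x y.
by rewrite !phiE mulrDl lmonoD.
Qed.

Lemma lmulA : associative lmul.
Proof.
move=> p q r; elim/laurent_ind: p => [|p p' IH IH'|c i].
- by rewrite ![lmul 0 _]lmulC !lmul0 lmulC lmul0.
- by rewrite !lmulDl IH IH'.
elim/laurent_ind: q => [|q q' IH IH'|d j].
- by rewrite lmul0 ![lmul 0 _]lmulC !lmul0.
- by rewrite lmulDl !lmulDr lmulDl IH IH'.
elim/laurent_ind: r => [|r r' IH IH'|e k]; first by rewrite !lmul0.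
  by rewrite !lmulDr IH IH'.
by rewrite !lmul_mono mulrA addrA.
Qed.

Lemma lmul1 : left_id lone lmul.
Proof.
elim/laurent_ind=> [|p q IH IH'|c i]; first by rewrite lmul0.
  by rewrite lmulDr IH IH'.
by rewrite lmul_mono mul1r add0r.
Qed.

Lemma lone_neq0 : lone != 0.
Proof. by rewrite monalgU_eq0 oner_eq0. Qed.

HB.instance Definition _ := GRing.Zmodule_isComNzRing.Build (laurent F)
  lmulA lmulC lmul1 lmulDl lone_neq0.

Lemma lmonoM c d i j : lmono c i * lmono d j = lmono (c * d) (i + j).
Proof. exact: lmul_mono. Qed.

Lemma lscaleAl (a : F) p q : a *: (p * q) = (a *: p) * q.
Proof.
elim/laurent_ind: p => [|p p' IH IH'|c i]; first by rewrite mul0r scaler0 mul0r.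
  by rewrite mulrDl !scalerDr mulrDl IH IH'.
elim/laurent_ind: q => [|q q' IH IH'|d j]; first by rewrite !mulr0 scaler0.
  by rewrite !mulrDr scalerDr IH IH'.
by rewrite lmonoM !lmono_scale lmonoM mulrA.
Qed.

HB.instance Definition _ := GRing.Lmodule_isLalgebra.Build F (laurent F) lscaleAl.
HB.instance Definition _ := GRing.Lalgebra_isComAlgebra.Build F (laurent F).

(* p(t) |-> p(t^-1) *)
Definition linv p : laurent F := \sum_(i <- msupp p) lmono p@_i (- i).

Lemma linv_mono c i : linv (lmono c i) = lmono c (- i).
Proof.
by rewrite [LHS](@lsum_mono _ (fun c i => lmono c (- i))) // => j; apply: lmonoD.
Qed.

Lemma linvD : {morph linv : p q / p + q}.
Proof.
by apply: (@lsumD _ (fun c i => lmono c (- i))) => j; apply: lmonoD.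
Qed.

Lemma linv0 : linv 0 = 0.
Proof. by apply: (addrI (linv 0)); rewrite -linvD !addr0. Qed.

Lemma linvN p : linv (- p) = - linv p.
Proof. by apply: (addrI (linv p)); rewrite -linvD !subrr linv0. Qed.

Lemma linv_is_linear : linear linv.
Proof.
move=> a p q; rewrite linvD; congr (_ + _).
elim/laurent_ind: p => [|p p' IH IH'|c i]; first by rewrite linv0 !scaler0 linv0.
  by rewrite !scalerDr !linvD !scalerDr IH IH'.
by rewrite lmono_scale !linv_mono lmono_scale.
Qed.

Lemma linvM : {morph linv : p q / p * q}.
Proof.
move=> p q; elim/laurent_ind: p => [|p p' IH IH'|c i].
- by rewrite mul0r linv0 mul0r.
- by rewrite linvD !mulrDl linvD IH IH'.
elim/laurent_ind: q => [|q q' IH IH'|d j]; first by rewrite mulr0 linv0 mulr0.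
  by rewrite linvD !mulrDr linvD IH IH'.
by rewrite lmonoM !linv_mono lmonoM opprD.
Qed.

Lemma linv1 : linv 1 = 1.
Proof. exact: linv_mono. Qed.

HB.instance Definition _ :=
  GRing.isLinear.Build F (laurent F) (laurent F) *:%R linv linv_is_linear.
HB.instance Definition _ :=
  GRing.isMonoidMorphism.Build (laurent F) (laurent F) linv (linv1, linvM).

Lemma linvK : involutive linv.
Proof.
elim/laurent_ind=> [|p q IH IH'|c i]; first by rewrite !linv0.
  by rewrite !linvD IH IH'.
by rewrite !linv_mono opprK.
Qed.

Definition leval (x : F) p : F := \sum_(i <- msupp p) p@_i * x ^ i.

Lemma leval_mono x c i : leval x (lmono c i) = c * x ^ i.
Proof.
by rewrite [LHS](@lsum_mono _ (fun c i => c * x ^ i)) // => j a b; rewrite mulrDl.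
Qed.

Lemma levalD x : {morph leval x : p q / p + q}.
Proof.
by apply: (@lsumD _ (fun c i => c * x ^ i)) => j a b; rewrite mulrDl.
Qed.

Lemma leval0 x : leval x 0 = 0.
Proof. by apply: (addrI (leval x 0)); rewrite -levalD !addr0. Qed.

Lemma levalN x p : leval x (- p) = - leval x p.
Proof. by apply: (addrI (leval x p)); rewrite -levalD !subrr leval0. Qed.

Lemma levalZ x a p : leval x (a *: p) = a * leval x p.
Proof.
elim/laurent_ind: p => [|p q IH IH'|c i].
- by rewrite scaler0 leval0 mulr0.
- by rewrite scalerDr !levalD mulrDr IH IH'.
- by rewrite lmono_scale !leval_mono mulrA.
Qed.

Lemma levalM x p q : x != 0 -> leval x (p * q) = leval x p * leval x q.
Proof.
move=> x_neq0; elim/laurent_ind: p => [|p p' IH IH'|c i].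
- by rewrite mul0r leval0 mul0r.
- by rewrite levalD !mulrDl levalD IH IH'.
elim/laurent_ind: q => [|q q' IH IH'|d j]; first by rewrite mulr0 leval0 mulr0.
  by rewrite levalD !mulrDr levalD IH IH'.
by rewrite lmonoM !leval_mono expfzDr // mulrACA.
Qed.

Lemma leval_linv x p : leval x (linv p) = leval x^-1 p.
Proof.
elim/laurent_ind: p => [|p q IH IH'|c i]; first by rewrite linv0 !leval0.
  by rewrite linvD !levalD IH IH'.
by rewrite linv_mono !leval_mono exprz_inv.
Qed.

Definition tpos : laurent F := lmono 1 1.
Definition tneg : laurent F := lmono 1 (- 1).

Lemma tposV : tpos * tneg = 1.
Proof. by rewrite lmonoM mulr1. Qed.

Lemma linv_tpos : linv tpos = tneg.
Proof. exact: linv_mono. Qed.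

Lemma linv_tneg : linv tneg = tpos.
Proof. by rewrite linv_mono opprK. Qed.

End Laurent.

Lemma mx_jacobi (A : comNzRingType) n (x y z : 'M[A]_n) :
  (x *m (y *m z - z *m y) - (y *m z - z *m y) *m x) +
  (y *m (z *m x - x *m z) - (z *m x - x *m z) *m y) +
  (z *m (x *m y - y *m x) - (x *m y - y *m x) *m z) = 0.
Proof.
have aux (a b c d : 'M[A]_n) : a - b - (c - d) = a + d - (b + c).
  by rewrite opprB addrACA -opprD.
rewrite !mulmxBr !mulmxBl !mulmxA !aux.
rewrite [x *m z *m y + _]addrC subrKA.
rewrite [y *m x *m z + _]addrC subrKA.
by rewrite [z *m y *m x + _]addrC subrr.
Qed.

(* The alias replaces the module structure over (laurent F) by one over F. *)
Definition loop_gl2 (F : fieldType) : Type := 'M[laurent F]_2.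

Section Loop.
Context (F : fieldType).
Implicit Types x y z : loop_gl2 F.

HB.instance Definition _ := GRing.Zmodule.copy (loop_gl2 F) 'M[laurent F]_2.

Definition loop_scale (a : F) x : loop_gl2 F := map_mx (fun p => a *: p) x.

Lemma loop_scaleA a b x : loop_scale a (loop_scale b x) = loop_scale (a * b) x.
Proof. by apply/matrixP => i j; rewrite !mxE scalerA. Qed.

Lemma loop_scale1 : left_id 1 loop_scale.
Proof. by move=> x; apply/matrixP => i j; rewrite !mxE scale1r. Qed.

Lemma loop_scaleDr : right_distributive loop_scale +%R.
Proof. by move=> a x y; apply/matrixP => i j; rewrite !mxE scalerDr. Qed.

Lemma loop_scaleDl x : {morph loop_scale^~ x : a b / a + b}.
Proof. by move=> a b; apply/matrixP => i j; rewrite !mxE scalerDl. Qed.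

HB.instance Definition _ := GRing.Zmodule_isLmodule.Build F (loop_gl2 F)
  loop_scaleA loop_scale1 loop_scaleDr loop_scaleDl.

Lemma loop_scaleE (a : F) x : a *: x = a%:A *: (x : 'M[laurent F]_2).
Proof. by apply/matrixP => i j; rewrite !mxE mulr_algl. Qed.

Definition loop_bracket x y : loop_gl2 F := x *m y - y *m x.

Lemma loop_linear_l (a : F) x y z : loop_bracket (a *: x + y) z =
  a *: loop_bracket x z + loop_bracket y z.
Proof.
rewrite /loop_bracket !loop_scaleE mulmxDl mulmxDr -scalemxAl -scalemxAr.
by rewrite scalerBr opprD addrACA.
Qed.

Lemma loop_alt x : loop_bracket x x = 0.
Proof. exact: subrr. Qed.

Lemma loop_linear_r (a : F) x y z : loop_bracket x (a *: y + z) =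
  a *: loop_bracket x y + loop_bracket x z.
Proof.
rewrite /loop_bracket !loop_scaleE mulmxDl mulmxDr -scalemxAl -scalemxAr.
by rewrite scalerBr opprD addrACA.
Qed.

Lemma loop_jacobi x y z :
  loop_bracket x (loop_bracket y z) + loop_bracket y (loop_bracket z x) +
  loop_bracket z (loop_bracket x y) = 0.
Proof.
exact: mx_jacobi.
Qed.

HB.instance Definition _ := Lmodule_isLieAlgebra.Build F (loop_gl2 F)
  loop_linear_l loop_linear_r loop_alt loop_jacobi.

Definition mx2 (a b c d : laurent F) : loop_gl2 F :=
  \matrix_(i, j) if i == 0 then (if j == 0 then a else b)
                 else (if j == 0 then c else d).

Lemma ord2P (P : 'I_2 -> Prop) : P 0 -> P 1 -> forall i, P i.
Proof.
move=> P0 P1 [[|[|//]] i_lt2].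
  by rewrite (_ : Ordinal i_lt2 = 0) //; apply/val_inj.
by rewrite (_ : Ordinal i_lt2 = 1) //; apply/val_inj.
Qed.

Lemma loop_eqP x y : x 0 0 = y 0 0 -> x 0 1 = y 0 1 -> x 1 0 = y 1 0 ->
  x 1 1 = y 1 1 -> x = y.
Proof.
by move=> e00 e01 e10 e11; apply/matrixP; elim/ord2P; elim/ord2P.
Qed.

Lemma mulmx2E x y i j : (x *m y) i j = x i 0 * y 0 j + x i 1 * y 1 j.
Proof.
rewrite mxE !big_ord_recl big_ord0 addr0.
by congr (_ + x i _ * y _ j); apply/val_inj.
Qed.

Lemma loop_bracketE x y i j : [lie x, y] i j =
  (x i 0 * y 0 j + x i 1 * y 1 j) - (y i 0 * x 0 j + y i 1 * x 1 j).
Proof. by rewrite -!mulmx2E [LHS]mxE; congr (_ + _); exact: mxE. Qed.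

Lemma loopDE x y i j : (x + y) i j = x i j + y i j.
Proof. exact: mxE. Qed.

Lemma loopZE (a : F) x i j : (a *: x) i j = a *: x i j.
Proof. by rewrite [LHS]mxE. Qed.

Definition theta x : loop_gl2 F :=
  mx2 (linv (x 1 1)) (linv (x 1 0)) (linv (x 0 1)) (linv (x 0 0)).

Definition epsilon x : F := leval 1 (x 0 0) + leval 1 (x 1 1).

Lemma theta_lie_morphism : lie_morphism theta.
Proof.
split=> [a x y|x y].
  by apply: loop_eqP; rewrite loopDE loopZE ![theta _ _ _]mxE /=
    loopDE loopZE linearP.
by apply: loop_eqP; rewrite loop_bracketE ![theta _ _ _]mxE /= loop_bracketE;
  rewrite rmorphB !rmorphD !rmorphM; ring.
Qed.

Lemma thetaK : involutive theta.
Proof. by move=> x; apply: loop_eqP; rewrite !mxE /= linvK. Qed.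

Lemma epsilonP (a : F) x y : epsilon (a *: x + y) = a * epsilon x + epsilon y.
Proof. by rewrite /epsilon !loopDE !loopZE !levalD !levalZ; ring. Qed.

Lemma epsilon_bracket x y : epsilon [lie x, y] = 0.
Proof.
rewrite /epsilon !loop_bracketE !levalD !levalN !levalD.
by rewrite !levalM ?oner_eq0 //; ring.
Qed.

Definition calL : {pred loop_gl2 F} := [pred x | epsilon x == 0].

Definition calO_pred : {pred loop_gl2 F} :=
  [pred x | (x \in calL) && (theta x == x)].

Lemma calO_predP x : reflect (epsilon x = 0 /\ theta x = x) (x \in calO_pred).
Proof. by apply: (iffP andP) => -[/eqP ? /eqP ?]. Qed.

Lemma calO_submod : submod_closed calO_pred.
Proof.
split=> [|a x y /calO_predP[ex tx] /calO_predP[ey ty]]; apply/calO_predP.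
  split; first by rewrite /epsilon !mxE leval0 addr0.
  by apply: loop_eqP; rewrite !mxE /= ?linv0.
by rewrite epsilonP ex ey mulr0 addr0 theta_lie_morphism.1 tx ty.
Qed.

Lemma calO_bracket x y :
  x \in calO_pred -> y \in calO_pred -> [lie x, y] \in calO_pred.
Proof.
move=> /calO_predP[_ tx] /calO_predP[_ ty]; apply/calO_predP.
by rewrite epsilon_bracket theta_lie_morphism.2 tx ty.
Qed.

HB.instance Definition _ :=
  GRing.isSubmodClosed.Build F (loop_gl2 F) calO_pred calO_submod.

Record calO : Type := CalO { calO_val : loop_gl2 F; _ : calO_val \in calO_pred }.

HB.instance Definition _ := [isSub for calO_val].
HB.instance Definition _ := [Choice of calO by <:].
HB.instance Definition _ := [SubChoice_isSubLmodule of calO by <:].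

Implicit Types u v w : calO.

Definition calO_lieb u v : calO := CalO (calO_bracket (valP u) (valP v)).

Lemma calO_linear_l (a : F) u v w : calO_lieb (a *: u + v) w =
  a *: calO_lieb u w + calO_lieb v w.
Proof. by apply/val_inj; exact: lieb_linear_l. Qed.

Lemma calO_linear_r (a : F) u v w : calO_lieb u (a *: v + w) =
  a *: calO_lieb u v + calO_lieb u w.
Proof. by apply/val_inj; exact: lieb_linear_r. Qed.

Lemma calO_alt u : calO_lieb u u = 0.
Proof. by apply/val_inj; exact: liebxx. Qed.

Lemma calO_jacobi u v w : calO_lieb u (calO_lieb v w) +
  calO_lieb v (calO_lieb w u) + calO_lieb w (calO_lieb u v) = 0.
Proof. by apply/val_inj; exact: lieb_jacobi. Qed.

HB.instance Definition _ := Lmodule_isLieAlgebra.Build F calO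
  calO_linear_l calO_linear_r calO_alt calO_jacobi.

End Loop.

(* Wneg k, Wpos k, Gpos k, Gtil k stand for
   W_{-k}, W_{k+1}, G_{k+1}, \tilde G_{k+1}. *)
Inductive gen : Type :=
| Wneg of nat
| Wpos of nat
| Gpos of nat
| Gtil of nat.

Section Generators.
Context (F : fieldType).

Local Notation t := (tpos F).
Local Notation t' := (tneg F).

Definition tav : laurent F := 2^-1 *: (t + t').

Definition gen_mx (g : gen) : loop_gl2 F :=
  match g with
  | Wneg k => tav ^+ k *: (mx2 0 1 1 0 : 'M[laurent F]_2)
  | Wpos k => tav ^+ k *: (mx2 0 t t' 0 : 'M[laurent F]_2)
  | Gpos k => tav ^+ k *: (mx2 (t *+ 2 - 2) 0 0 (t' *+ 2 - 2) : 'M[laurent F]_2)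
  | Gtil k => tav ^+ k *: (mx2 (t' *+ 2 - 2) 0 0 (t *+ 2 - 2) : 'M[laurent F]_2)
  end.

Lemma linv_tav : linv tav = tav.
Proof. by rewrite linearZ linearD /= linv_tpos linv_tneg addrC. Qed.

Lemma gen_mx_in_calO g : gen_mx g \in @calO_pred F.
Proof.
apply/calO_predP; split.
  case: g => k; rewrite /epsilon !mxE /= ?mulr0 ?leval0 ?addr0 // -levalD -mulrDr.
    rewrite levalM ?oner_eq0 //.
    by rewrite !(levalD, levalN, mulr2n, leval_mono, exp1rz); ring.
  rewrite levalM ?oner_eq0 //.
  by rewrite !(levalD, levalN, mulr2n, leval_mono, exp1rz); ring.
case: g => k; apply: loop_eqP; rewrite !mxE /= rmorphM rmorphXn /= linv_tav.
all: by rewrite ?rmorphB ?rmorph_nat ?rmorphMn ?rmorph0 ?rmorph1 /=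
  ?linv_tpos ?linv_tneg.
Qed.

Definition gen_calO (g : gen) : calO F := CalO (gen_mx_in_calO g).

Local Notation term := (lie_term F gen).
Local Notation Wm k := (LGen (Wneg k)).
Local Notation Wp k := (LGen (Wpos k)).
Local Notation G k := (LGen (Gpos k)).
Local Notation Gt k := (LGen (Gtil k)).
Local Notation half := (2^-1 : F)%R (only parsing).
Local Notation four := (4 : F)%R (only parsing).

(* The index shift of gen: W_0 is Wm 0, W_1 is Wp 0, W_{-k-1} is Wm k.+1 and
   W_{k+2} is Wp k.+1. *)
Inductive calO_rel : term -> term -> Prop :=
| rel_W0_W k : calO_rel [lie Wm 0, Wp k] (half *: (Gt k - G k))
| rel_W_W1 k : calO_rel [lie Wm k, Wp 0] (half *: (Gt k - G k))
| rel_W0_G k : calO_rel [lie Wm 0, G k] (four *: Wm k.+1 - four *: Wp k)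
| rel_Gt_W0 k : calO_rel [lie Gt k, Wm 0] (four *: Wm k.+1 - four *: Wp k)
| rel_G_W1 k : calO_rel [lie G k, Wp 0] (four *: Wp k.+1 - four *: Wm k)
| rel_W1_Gt k : calO_rel [lie Wp 0, Gt k] (four *: Wp k.+1 - four *: Wm k)
| rel_Wm_Wm k l : calO_rel [lie Wm k, Wm l] 0
| rel_Wp_Wp k l : calO_rel [lie Wp k, Wp l] 0
| rel_Wm_Wp k l : calO_rel ([lie Wm k, Wp l] + [lie Wp k, Wm l]) 0
| rel_Wm_G k l : calO_rel ([lie Wm k, G l] + [lie G k, Wm l]) 0
| rel_Wm_Gt k l : calO_rel ([lie Wm k, Gt l] + [lie Gt k, Wm l]) 0
| rel_Wp_G k l : calO_rel ([lie Wp k, G l] + [lie G k, Wp l]) 0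
| rel_Wp_Gt k l : calO_rel ([lie Wp k, Gt l] + [lie Gt k, Wp l]) 0
| rel_G_G k l : calO_rel [lie G k, G l] 0
| rel_Gt_Gt k l : calO_rel [lie Gt k, Gt l] 0
| rel_Gt_G k l : calO_rel ([lie Gt k, G l] + [lie G k, Gt l]) 0.

End Generators.

(* Main.v *)
Require Import Defs.
From mathcomp Require Import all_boot all_order all_algebra.
From HB Require Import structures.
From mathcomp Require Import boolp ring.

Set Implicit Arguments.
Unset Strict Implicit.
Unset Printing Implicit Defensive.

Import GRing.Theory.

Local Open Scope ring_scope.

(** Write A_k, B_k, G_k, H_k for the generators W_{-k}, W_{k+1}, G_{k+1} and
Gtilde_{k+1}, and put D_k = (H_k - G_k) / 2, E_k = G_k + H_k. In the loop
algebra, with s = (t + t^-1) / 2, these are s^k times, respectively, the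
matrices with upper rows (0, 1), (0, t), (t^-1 - t, 0), (4 (s - 1), 0); the
lower row is forced by invariance under theta. Since F[t, t^-1] is free over
F[s] with basis 1, t, and since a diagonal entry must vanish at t = 1, the
families A, B, D, E form a basis of O ([basis_comb_eq0], [basis_comb_surj]).

It remains to see that the presented algebra is no larger, that is, that A, B,
D, E span it. As they span all generators, it suffices that the relations
determine every bracket of two of them as a combination of them:
- A_0 and B_0 generate all A_k, B_k, D_k ([A_succ], [B_succ]) and commute with
  every E_l; hence E_l is central among these elements ([lie_E_AB]);
- [D_k, D_l] = 0 is immediate, and expanding [A_k, [B_0, D_l]] with Jacobi then
  gives [A_k, B_{l+1}] = [A_{k+1}, B_l], so that [A_k, B_l] depends only on
  k + l and equals [A_0, B_{k+l}] = D_{k+l} ([lie_A_B]);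
- consequently [A_k, D_l] = [A_k, [A_0, B_l]] = [A_0, D_{k+l}], and likewise for
  B; both are given by the relations ([lie_A_D], [lie_B_D]).

The homomorphism from the presented algebra to O therefore carries a spanning
family to a basis, indexed the same way, and is bijective. Linear combinations
of the four families are encoded by four polynomials, so that in O they become
the values of these polynomials at s. *)

(** * Brackets in a Lie algebra *)

Section Lie.
Context (F : fieldType) (L : lieAlgType F).
Implicit Types x y z : L.

Lemma lieDl x y z : [lie x + y, z] = [lie x, z] + [lie y, z].
Proof. by have := lieb_linear_l 1 x y z; rewrite !scale1r. Qed.

Lemma lieDr x y z : [lie x, y + z] = [lie x, y] + [lie x, z].
Proof. by have := lieb_linear_r 1 x y z; rewrite !scale1r. Qed.

Lemma lie0r x : [lie x, 0] = 0.
Proof. by apply: (addrI [lie x, 0]); rewrite -lieDr !addr0. Qed.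

Lemma lie0l x : [lie 0, x] = 0.
Proof. by apply: (addrI [lie 0, x]); rewrite -lieDl !addr0. Qed.

Lemma lieZl a x y : [lie a *: x, y] = a *: [lie x, y].
Proof. by rewrite -[a *: x]addr0 lieb_linear_l lie0l addr0. Qed.

Lemma lieZr a x y : [lie x, a *: y] = a *: [lie x, y].
Proof. by rewrite -[a *: y]addr0 lieb_linear_r lie0r addr0. Qed.

Lemma lieNl x y : [lie - x, y] = - [lie x, y].
Proof. by rewrite -scaleN1r lieZl scaleN1r. Qed.

Lemma lieNr x y : [lie x, - y] = - [lie x, y].
Proof. by rewrite -scaleN1r lieZr scaleN1r. Qed.

Lemma lieC x y : [lie x, y] = - [lie y, x].
Proof.
apply/eqP; rewrite -addr_eq0; apply/eqP.
by have := liebxx (x + y); rewrite lieDl !lieDr !liebxx add0r addr0.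
Qed.

Lemma lie_leibniz x y z :
  [lie x, [lie y, z]] = [lie [lie x, y], z] + [lie y, [lie x, z]].
Proof.
apply/eqP; rewrite -subr_eq0 opprD; apply/eqP;
  rewrite -[RHS](lieb_jacobi x y z).
by rewrite -lieC [in RHS](lieC z x) lieNr addrAC addrA.
Qed.

End Lie.

(** * The bracket table forced by the relations *)

Lemma nat_neq0 (F : fieldType) (charF0 : [pchar F] =i pred0) n :
  (0 < n)%N -> n%:R != 0 :> F.
Proof. by move=> n_gt0; rewrite (pcharf0P F).1 // -lt0n. Qed.

Section Table.
Context (F : fieldType) (charF0 : [pchar F] =i pred0).
Context (L : lieAlgType F) (v : gen -> L).
Hypothesis vR : forall x y, calO_rel x y -> lie_eval v x = lie_eval v y.

Local Notation A k := (v (Wneg k)).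
Local Notation B k := (v (Wpos k)).
Local Notation G k := (v (Gpos k)).
Local Notation H k := (v (Gtil k)).

Let rel_A0_G k : [lie A 0, G k] = (4 : F) *: A k.+1 - (4 : F) *: B k :=
  vR (rel_W0_G F k).
Let rel_H_A0 k : [lie H k, A 0] = (4 : F) *: A k.+1 - (4 : F) *: B k :=
  vR (rel_Gt_W0 F k).
Let rel_G_B0 k : [lie G k, B 0] = (4 : F) *: B k.+1 - (4 : F) *: A k :=
  vR (rel_G_W1 F k).
Let rel_B0_H k : [lie B 0, H k] = (4 : F) *: B k.+1 - (4 : F) *: A k :=
  vR (rel_W1_Gt F k).
Let rel_GG k l : [lie G k, G l] = 0 := vR (rel_G_G F k l).
Let rel_HH k l : [lie H k, H l] = 0 := vR (rel_Gt_Gt F k l).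
Let rel_HG k l : [lie H k, G l] + [lie G k, H l] = 0 := vR (rel_Gt_G F k l).
Let rel_AG k l : [lie A k, G l] + [lie G k, A l] = 0 := vR (rel_Wm_G F k l).
Let rel_AH k l : [lie A k, H l] + [lie H k, A l] = 0 := vR (rel_Wm_Gt F k l).
Let rel_AB k l : [lie A k, B l] + [lie B k, A l] = 0 := vR (rel_Wm_Wp F k l).

Definition Gdiff k : L := 2^-1 *: (H k - G k).
Definition Gsum k : L := G k + H k.
Local Notation D := Gdiff.
Local Notation E := Gsum.

Let half_double (x : L) : 2^-1 *: (x + x) = x.
Proof. by rewrite -mulr2n -scaler_nat scalerA mulVf ?scale1r ?nat_neq0. Qed.

Let four_inj (x y : L) : (4 : F) *: x = (4 : F) *: y -> x = y.
Proof. by apply: scalerI; rewrite nat_neq0. Qed.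

Lemma Gpos_DE k : G k = 2^-1 *: E k - D k.
Proof. by rewrite -scalerBr /Gsum opprB addrACA subrr addr0 half_double. Qed.

Lemma Gtil_DE k : H k = 2^-1 *: E k + D k.
Proof. by rewrite -scalerDr /Gsum [G k + _]addrC addrACA subrr addr0 half_double. Qed.

Lemma lie_A0_D k : [lie A 0, D k] = (4 : F) *: B k - (4 : F) *: A k.+1.
Proof.
rewrite lieZr lieDr lieNr rel_A0_G lieC rel_H_A0 /=.
by rewrite !opprB half_double.
Qed.

Lemma lie_B0_D k : [lie B 0, D k] = (4 : F) *: B k.+1 - (4 : F) *: A k.
Proof.
rewrite lieZr lieDr lieNr -lieC rel_G_B0 rel_B0_H /=.
by rewrite half_double.
Qed.

(** This and the next lemma recover A_{k+1} and B_{k+1} from lower terms by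
bracketing with A_0 and B_0: the source of the induction in [lie_E_AB]. *)
Lemma A_succ k : A k.+1 = B k - 4^-1 *: [lie A 0, D k].
Proof.
by rewrite lie_A0_D -scalerBr scalerA mulVf ?nat_neq0 // scale1r opprB addrC subrK.
Qed.

Lemma B_succ k : B k.+1 = A k + 4^-1 *: [lie B 0, D k].
Proof.
by rewrite lie_B0_D -scalerBr scalerA mulVf ?nat_neq0 // scale1r addrC subrK.
Qed.

Lemma lie_A0_B k : [lie A 0, B k] = D k.
Proof. exact: vR (rel_W0_W F k). Qed.

Lemma lie_A_B0 k : [lie A k, B 0] = D k.
Proof. exact: vR (rel_W_W1 F k). Qed.

Lemma lie_A0_E k : [lie A 0, E k] = 0.
Proof.
by rewrite lieDr rel_A0_G lieC rel_H_A0 /= subrr.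
Qed.

Lemma lie_B0_E k : [lie B 0, E k] = 0.
Proof.
by rewrite lieDr [X in X + _]lieC rel_G_B0 rel_B0_H /= addNr.
Qed.

(** The centralizer of E_l is a Lie subalgebra containing A_0 and B_0, and
these two generate all A_k and B_k. *)
Lemma lie_E_AB l k : [lie E l, A k] = 0 /\ [lie E l, B k] = 0.
Proof.
have A0 : [lie E l, A 0] = 0 by rewrite lieC lie_A0_E oppr0.
have B0 : [lie E l, B 0] = 0 by rewrite lieC lie_B0_E oppr0.
elim: k => [//|k [Ak Bk]].
have Dk : [lie E l, D k] = 0.
  by rewrite -lie_A0_B lie_leibniz A0 Bk lie0l lie0r addr0.
have closed x : [lie E l, x] = 0 -> [lie E l, [lie x, D k]] = 0.
  by move=> x0; rewrite lie_leibniz x0 Dk lie0l lie0r addr0.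
rewrite A_succ B_succ !lieDr lieNr !(lieZr 4^-1) Ak Bk !closed //.
by rewrite scaler0 subr0 addr0.
Qed.

Lemma lie_E_A l k : [lie E l, A k] = 0. Proof. by case: (lie_E_AB l k). Qed.
Lemma lie_E_B l k : [lie E l, B k] = 0. Proof. by case: (lie_E_AB l k). Qed.

Lemma lie_E_D l k : [lie E l, D k] = 0.
Proof. by rewrite -lie_A0_B lie_leibniz lie_E_A lie_E_B lie0l lie0r addr0. Qed.

Lemma lie_A_A k l : [lie A k, A l] = 0.
Proof. exact: vR (rel_Wm_Wm F k l). Qed.

Lemma lie_B_B k l : [lie B k, B l] = 0.
Proof. exact: vR (rel_Wp_Wp F k l). Qed.

Lemma lie_D_D k l : [lie D k, D l] = 0.
Proof.
rewrite lieZl lieZr !lieDl !lieDr !lieNl !lieNr opprK.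
rewrite rel_GG rel_HH /= add0r addr0.
by rewrite -opprD rel_HG oppr0 !scaler0.
Qed.

Lemma lie_E_E k l : [lie E k, E l] = 0.
Proof.
rewrite !lieDl !lieDr rel_GG rel_HH /= add0r addr0.
by rewrite addrC rel_HG.
Qed.

Lemma lie_A_D_sym k l : [lie A k, D l] = [lie A l, D k].
Proof.
have AG : [lie A k, G l] = [lie A l, G k].
  by apply/eqP; rewrite -subr_eq0 -lieC rel_AG.
have AH : [lie A k, H l] = [lie A l, H k].
  by apply/eqP; rewrite -subr_eq0 -lieC rel_AH.
by rewrite !lieZr !lieDr !lieNr AG AH.
Qed.

Lemma lie_A_B_sym k l : [lie A k, B l] = [lie A l, B k].
Proof. by apply/eqP; rewrite -subr_eq0 -lieC rel_AB. Qed.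

(** Expanding [A_i, [B_0, D_j]] by the Leibniz rule leaves [B_0, [A_i, D_j]],
because [[A_i, B_0], D_j] = [D_i, D_j] = 0, whereas the relations turn it into
4 [A_i, B_{j+1}]. The symmetry of [A_i, D_j] in i and j thus passes to
[A_i, B_{j+1}]. *)
Lemma lie_A_B_shift k l : [lie A k, B l.+1] = [lie A k.+1, B l].
Proof.
have AV i j : (4 : F) *: [lie A i, B j.+1] = [lie B 0, [lie A i, D j]].
  have := lie_leibniz (A i) (B 0) (D j).
  rewrite lie_A_B0 lie_D_D add0r => <-.
  by rewrite lie_B0_D lieDr lieNr !lieZr lie_A_A scaler0 subr0.
by rewrite [RHS]lie_A_B_sym; apply: four_inj; rewrite !AV lie_A_D_sym.
Qed.

Lemma lie_A_B k l : [lie A k, B l] = D (k + l).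
Proof.
elim: k l => [|k IH] l; first exact: lie_A0_B.
by rewrite -lie_A_B_shift IH addnS.
Qed.

(** D_l = [A_0, B_l] and [A_k, A_0] = 0, so ad A_k only acts on B_l. *)
Lemma lie_A_D k l :
  [lie A k, D l] = (4 : F) *: B (k + l) - (4 : F) *: A (k + l).+1.
Proof.
rewrite -lie_A0_D -lie_A0_B lie_leibniz lie_A_A lie0l add0r.
by rewrite lie_A_B.
Qed.

Lemma lie_B_D k l :
  [lie B k, D l] = (4 : F) *: B (k + l).+1 - (4 : F) *: A (k + l).
Proof.
rewrite -lie_B0_D -lie_A_B0 lie_leibniz lie_B_B lie0r addr0.
by rewrite [X in [lie X, _]]lieC lie_A_B lieNl -lieC addnC.
Qed.

End Table.

(** * Linear combinations encoded by polynomials *)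

Section PolyComb.
Context (F : fieldType) (V : lmodType F).
Implicit Types (a : nat -> V) (p q : {poly F}).

Definition pcomb a p : V := \sum_(i < size p) p`_i *: a i.

Lemma pcombEw a p n : (size p <= n)%N -> pcomb a p = \sum_(i < n) p`_i *: a i.
Proof.
move=> le_pn; rewrite /pcomb (big_ord_widen n (fun i => p`_i *: a i) le_pn).
rewrite [RHS](bigID (fun i : 'I_n => i < size p)%N) /= [X in _ = _ + X]big1 ?addr0 //.
by move=> i; rewrite -leqNgt => le_pi; rewrite nth_default // scale0r.
Qed.

Lemma pcomb_is_linear a : linear (pcomb a).
Proof.
move=> c p q; pose n := maxn (size p) (size q).
have le_pn : (size p <= n)%N by apply: leq_maxl.
have le_qn : (size q <= n)%N by apply: leq_maxr.
rewrite (pcombEw a le_pn) (pcombEw a le_qn) (@pcombEw _ _ n); last first.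
  apply: leq_trans (size_polyD _ _) _; rewrite geq_max le_qn andbT.
  exact: leq_trans (size_scale_leq _ _) le_pn.
rewrite scaler_sumr -big_split; apply: eq_bigr => i _ /=.
by rewrite coefD coefZ scalerDl scalerA.
Qed.

HB.instance Definition _ a :=
  GRing.isLinear.Build F {poly F} V *:%R (pcomb a) (pcomb_is_linear a).

Lemma pcombXn a k : pcomb a 'X^k = a k.
Proof.
rewrite /pcomb size_polyXn big_ord_recr /= coefXn eqxx scale1r big1 ?add0r // => i _.
by rewrite coefXn ltn_eqF ?scale0r.
Qed.

End PolyComb.

Lemma linear_pcomb (F : fieldType) (V W : lmodType F)
    (h : {linear V -> W}) a p :
  h (pcomb a p) = pcomb (h \o a) p.
Proof. by rewrite linear_sum; apply: eq_bigr => i _; rewrite linearZ. Qed.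

Lemma pcomb_mul (F : fieldType) (R : comAlgType F) (s c : R) p :
  pcomb (fun k => s ^+ k * c) p = horner_alg s p * c.
Proof.
rewrite /pcomb /horner_alg /horner_morph horner_coef size_map_poly mulr_suml.
by apply: eq_bigr => i _; rewrite coef_map /= -scalerAl mul1r -scalerAl.
Qed.

Lemma pcomb_exp (F : fieldType) (R : comAlgType F) (s : R) p :
  pcomb (fun k => s ^+ k) p = horner_alg s p.
Proof.
rewrite -[RHS]mulr1 -pcomb_mul; congr (pcomb _ _).
by apply/funext => k; rewrite mulr1.
Qed.

Lemma pcomb0 (F : fieldType) (V : lmodType F) (p : {poly F}) :
  pcomb (fun=> 0 : V) p = 0.
Proof. by rewrite /pcomb big1 // => i _; rewrite scaler0. Qed.

(** * The spanning family *)

Section Span.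
Context (F : fieldType) (charF0 : [pchar F] =i pred0).
Context (L : lieAlgType F) (v : gen -> L).
Hypothesis vR : forall x y, calO_rel x y -> lie_eval v x = lie_eval v y.

Definition basis_comb (p q r s : {poly F}) : L :=
  pcomb (v \o Wneg) p + pcomb (v \o Wpos) q + pcomb (Gdiff v) r + pcomb (Gsum v) s.

Lemma linear_basis_comb (V : lmodType F) (h : {linear L -> V})
    (a b d e : nat -> V) :
    (forall k, h (v (Wneg k)) = a k) -> (forall k, h (v (Wpos k)) = b k) ->
    (forall k, h (Gdiff v k) = d k) -> (forall k, h (Gsum v k) = e k) ->
  forall p q r s,
    h (basis_comb p q r s) = pcomb a p + pcomb b q + pcomb d r + pcomb e s.
Proof.
move=> /funext <- /funext <- /funext <- /funext <- p q r s.
by rewrite !linearD !linear_pcomb.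
Qed.

Definition spanned (x : L) := exists p q r s, x = basis_comb p q r s.

Lemma spanned_lin c x y : spanned x -> spanned y -> spanned (c *: x + y).
Proof.
move=> [p [q [r [s ->]]]] [p' [q' [r' [s' ->]]]].
exists (c *: p + p'), (c *: q + q'), (c *: r + r'), (c *: s + s').
by rewrite /basis_comb !linearP !scalerDr; do 3![rewrite addrACA;
  congr (_ + _)].
Qed.

Lemma spanned0 : spanned 0.
Proof. by exists 0, 0, 0, 0; rewrite /basis_comb !linear0 !addr0. Qed.

Lemma spannedZ c x : spanned x -> spanned (c *: x).
Proof. by move=> Sx; rewrite -[_ *: _]addr0; apply: spanned_lin spanned0. Qed.

Lemma spannedD x y : spanned x -> spanned y -> spanned (x + y).
Proof. by move=> Sx Sy; rewrite -[x]scale1r; apply: spanned_lin. Qed.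

Lemma spannedN x : spanned x -> spanned (- x).
Proof. by rewrite -scaleN1r; apply: spannedZ. Qed.

Lemma spanned_A k : spanned (v (Wneg k)).
Proof. by exists 'X^k, 0, 0, 0;
  rewrite /basis_comb pcombXn !linear0 !addr0. Qed.
Lemma spanned_B k : spanned (v (Wpos k)).
Proof. by exists 0, 'X^k, 0, 0;
  rewrite /basis_comb pcombXn !linear0 !addr0 add0r. Qed.
Lemma spanned_D k : spanned (Gdiff v k).
Proof. by exists 0, 0, 'X^k, 0;
  rewrite /basis_comb pcombXn !linear0 !addr0 !add0r. Qed.
Lemma spanned_E k : spanned (Gsum v k).
Proof. by exists 0, 0, 0, 'X^k;
  rewrite /basis_comb pcombXn !linear0 !add0r. Qed.

Lemma spanned_gen g : spanned (v g).
Proof.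
case: g => k; [exact: spanned_A|exact: spanned_B| |].
  rewrite Gpos_DE //; apply: spannedD; first exact/spannedZ/spanned_E.
  exact/spannedN/spanned_D.
rewrite Gtil_DE //; apply: spannedD; last exact: spanned_D.
exact/spannedZ/spanned_E.
Qed.

Lemma spanned_ind (P : L -> Prop) :
    P 0 -> (forall c x y, P x -> P y -> P (c *: x + y)) ->
    (forall k, P (v (Wneg k))) -> (forall k, P (v (Wpos k))) ->
    (forall k, P (Gdiff v k)) -> (forall k, P (Gsum v k)) ->
  forall x, spanned x -> P x.
Proof.
move=> P0 Plin PA PB PD PE _ [p [q [r [s ->]]]].
have Padd x y : P x -> P y -> P (x + y).
  by rewrite -{2}[x]scale1r; apply: Plin.
have Pcomb a : (forall k, P (a k)) -> forall p, P (pcomb a p).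
  move=> Pa p'; apply: big_ind => // i _.
  by rewrite -[_ *: _]addr0; apply: Plin.
by apply: Padd (Padd _ _ (Padd _ _ (Pcomb _ _ _) (Pcomb _ _ _)) (Pcomb _ _ _)) (Pcomb _ _ _).
Qed.

Lemma spanned_lie x y : spanned x -> spanned y -> spanned [lie x, y].
Proof.
have S4 i j : spanned ((4 : F) *: v (Wpos i) - (4 : F) *: v (Wneg j)).
  apply: spannedD; first exact/spannedZ/spanned_B.
  exact/spannedN/spannedZ/spanned_A.
have swap u w : spanned [lie w, u] -> spanned [lie u, w].
  by move=> Swu; rewrite lieC; apply: spannedN.
have SE l k : [/\ spanned [lie Gsum v l, v (Wneg k)],
    spanned [lie Gsum v l, v (Wpos k)] & spanned [lie Gsum v l, Gdiff v k]].
  rewrite (lie_E_A charF0 vR) (lie_E_B charF0 vR) (lie_E_D charF0 vR).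
  by split; exact: spanned0.
move=> Sx Sy; elim/spanned_ind: Sx => {x}.
- by rewrite lie0l; exact: spanned0.
- by move=> c u w Su Sw; rewrite lieb_linear_l; apply: spanned_lin.
all: move=> k; elim/spanned_ind: Sy => {y}.
all: try by rewrite lie0r; exact: spanned0.
all: try by move=> c u w Su Sw; rewrite lieb_linear_r; apply: spanned_lin.
all: move=> l.
- by rewrite (lie_A_A vR); exact: spanned0.
- by rewrite (lie_A_B charF0 vR); exact: spanned_D.
- by rewrite (lie_A_D charF0 vR).
- by apply: swap; case: (SE l k).
- by apply: swap; rewrite (lie_A_B charF0 vR); exact: spanned_D.
- by rewrite (lie_B_B vR); exact: spanned0.
- by rewrite (lie_B_D charF0 vR).
- by apply: swap; case: (SE l k).
- by apply: swap; rewrite (lie_A_D charF0 vR).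
- by apply: swap; rewrite (lie_B_D charF0 vR).
- by rewrite (lie_D_D vR); exact: spanned0.
- by apply: swap; case: (SE l k).
1-3: by case: (SE k l).
by rewrite (lie_E_E vR); exact: spanned0.
Qed.

(** For the universal choice of v, every element of the presented algebra is such
a value. *)
Lemma spanned_eval t : spanned (lie_eval v t).
Proof.
elim: t => /= [g||x IHx y IHy|x IHx|c x IHx|x IHx y IHy].
- exact: spanned_gen.
- exact: spanned0.
- exact: spannedD.
- exact: spannedN.
- exact: spannedZ.
- exact: spanned_lie.
Qed.

End Span.

(** * Laurent polynomials as a module over F[(t + t^-1)/2] *)

Section LaurentBasis.
Context (F : fieldType) (charF0 : [pchar F] =i pred0).
Local Notation t := (tpos F).
Local Notation t' := (tneg F).
Local Notation s := (tav F).
Local Notation ev := (horner_alg s).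

Lemma tav2 : s *+ 2 = t + t'.
Proof. by rewrite -scaler_nat scalerA mulfV ?scale1r ?nat_neq0. Qed.

Lemma leval_ev x p : x != 0 -> leval x (ev p) = p.[2^-1 * (x + x^-1)].
Proof.
move=> x0; have e1 c : leval x c%:A = c.
  by rewrite levalZ leval_mono mul1r expr0z mulr1.
elim/poly_ind: p => [|p c IH]; first by rewrite rmorph0 leval0 horner0.
rewrite rmorphD rmorphM /= horner_algX horner_algC levalD levalM // IH e1.
rewrite hornerMXaddC levalZ levalD !leval_mono !mul1r expr1z.
by rewrite -exprz_inv expr1z.
Qed.

Lemma linv_ev p : linv (ev p) = ev p.
Proof.
elim/poly_ind: p => [|p c IH]; first by rewrite !rmorph0.
by rewrite !rmorphD !rmorphM /= !horner_algX !horner_algC linv_tav IH linearZ rmorph1.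
Qed.

Lemma natr_inj : injective (fun n => n%:R : F).
Proof.
move=> m n; wlog le_mn : m n / (m <= n)%N => [wl|] /=.
  by case/orP: (leq_total m n) => le e; [|apply/esym]; apply: wl.
move/eqP; rewrite eq_sym -subr_eq0 -natrB // (pcharf0P F).1 // subn_eq0 => le_nm.
by apply/eqP; rewrite eqn_leq le_mn.
Qed.

(** x + 1/x = y + 1/y means (x - y) (x y - 1) = 0. *)
Lemma tav_eval_inj m n : (1 < m)%N -> (1 < n)%N ->
  (m%:R + m%:R^-1 : F) = n%:R + n%:R^-1 -> m = n.
Proof.
move=> m1 n1 e; apply: natr_inj => /=.
have m0 : m%:R != 0 :> F by rewrite nat_neq0 // ltnW.
have n0 : n%:R != 0 :> F by rewrite nat_neq0 // ltnW.
have mn : (m * n)%:R - 1 != 0 :> F.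
  rewrite subr_eq0 -[1]/(1%:R); apply/eqP => /natr_inj /eqP.
  by rewrite muln_eq1 eqn_leq leqNgt m1.
apply/eqP; rewrite -subr_eq0; apply/eqP/(mulIf mn); rewrite mul0r natrM.
transitivity (m%:R * n%:R * ((m%:R + m%:R^-1 : F) - (n%:R + n%:R^-1))).
  by field; rewrite m0 n0.
by rewrite e subrr mulr0.
Qed.

(** The values of (t + t^-1)/2 at the integers n > 1 are pairwise distinct, so
they are too many roots for a nonzero polynomial. *)
Lemma poly_eq0_tav (p : {poly F}) :
  (forall n, (1 < n)%N -> p.[2^-1 * (n%:R + n%:R^-1)] = 0) -> p = 0.
Proof.
move=> pn; apply/eqP; case: eqVneq => // p0.
pose rs := [seq 2^-1 * (n%:R + n%:R^-1 : F) | n <- iota 2 (size p)].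
have := @max_poly_roots _ p rs p0; rewrite size_map size_iota ltnn => -> //.
  by apply/allP => _ /mapP[n + ->]; rewrite mem_iota => /andP[n1 _];
    apply/eqP/pn.
rewrite map_inj_in_uniq ?iota_uniq // => m n; rewrite !mem_iota.
move=> /andP[m1 _] /andP[n1 _] e; apply: tav_eval_inj => //.
by apply: mulfI e; rewrite invr_eq0 nat_neq0.
Qed.

(** Applying t |-> t^-1 fixes p(s) and q(s), and subtracting eliminates p: this
leaves q(s) (t - t^-1) = 0, whence q vanishes at s evaluated at every integer
n > 1. *)
Lemma laurent_indep p q : ev p + ev q * t = 0 -> p = 0 /\ q = 0.
Proof.
move=> e; have q0 : q = 0.
  have e' : ev p + ev q * t' = 0.
    by have := congr1 (@linv F) e; rewrite linvD linvM !linv_ev linv_tpos linv0.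
  have {}e' : ev q * (t - t') = 0.
    transitivity (ev p + ev q * t - (ev p + ev q * t'));
      last by rewrite e e' subrr.
    ring.
  apply: poly_eq0_tav => n n1;
    have n0 : n%:R != 0 :> F by rewrite nat_neq0 // ltnW.
  have := congr1 (leval n%:R) e';
    rewrite levalM // leval_ev // levalD levalN leval0.
  rewrite !leval_mono !mul1r expr1z -exprz_inv expr1z => /eqP.
  rewrite mulf_eq0 => /orP[/eqP //|]; rewrite subr_eq0 => /eqP en.
  have /eqP : (n * n)%:R = 1%:R :> F by rewrite natrM {1}en mulVf.
  by move/eqP/natr_inj/eqP; rewrite muln_eq1 eqn_leq leqNgt n1.
split=> //; move: e; rewrite q0 rmorph0 mul0r addr0 => e.
apply: poly_eq0_tav => n n1;
  have n0 : n%:R != 0 :> F by rewrite nat_neq0 // ltnW.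
by rewrite -leval_ev // e leval0.
Qed.

(** F[s] + F[s] t is stable under multiplication by t and t^-1, since
t^2 = 2 s t - 1 and t^-1 = 2 s - t. *)
Lemma laurent_span x : exists p q, x = ev p + ev q * t.
Proof.
have t'E : t' = s *+ 2 - t by rewrite tav2 addrC addKr.
have tt : t * t = s * t *+ 2 - 1.
  by rewrite -mulrnAl tav2 -(tposV F); ring.
have Mt y : (exists p q, y = ev p + ev q * t) -> exists p q, y * t = ev p + ev q * t.
  move=> [p [q ->]]; exists (- q), (p + q * 'X *+ 2).
  rewrite rmorphN rmorphD rmorphMn rmorphM /= horner_algX mulrDl -mulrA tt;
    ring.
have Mt' y : (exists p q, y = ev p + ev q * t) -> exists p q, y * t' = ev p + ev q * t.
  move=> [p [q ->]]; exists (p * 'X *+ 2 + q), (- p).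
  rewrite rmorphN rmorphD rmorphMn rmorphM /= horner_algX mulrDl -mulrA tposV t'E; ring.
elim/laurent_ind: x => [|x y [p [q ->]] [p' [q' ->]]|c i].
- by exists 0, 0; rewrite !rmorph0 mul0r addr0.
- by exists (p + p'), (q + q'); rewrite !rmorphD mulrDl addrACA.
elim/int_rect: i => [|n IH|n IH].
- exists c%:P, 0; rewrite rmorph0 mul0r addr0 /= horner_algC.
  by rewrite [RHS]lmono_scale mulr1.
- have -> : lmono c n.+1%:Z = lmono c n * t by rewrite lmonoM mulr1 intS addrC.
  exact: Mt.
- have -> : lmono c (- n.+1%:Z) = lmono c (- n%:Z) * t'.
    by rewrite lmonoM mulr1 intS opprD addrC.
  exact: Mt'.
Qed.

End LaurentBasis.

(** * The relations hold in the loop algebra *)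

Definition gen_diag (R : nzRingType) (s t t' : R) (g : gen) : R :=
  match g with
  | Wneg k | Wpos k => 0
  | Gpos k => s ^+ k * (t *+ 2 - 2)
  | Gtil k => s ^+ k * (t' *+ 2 - 2)
  end.

Definition gen_off (R : nzRingType) (s t : R) (g : gen) : R :=
  match g with
  | Wneg k => s ^+ k
  | Wpos k => s ^+ k * t
  | Gpos k | Gtil k => 0
  end.

Section AbstractRelations.
Context (F : fieldType) (R : comAlgType F) (s t t' : R).
Context (L : lieAlgType F) (d o : {linear L -> R}) (v : gen -> L).
Local Notation dg := (gen_diag s t t').
Local Notation dg' := (gen_diag s t' t).
Local Notation og := (gen_off s t).
Local Notation og' := (gen_off s t').

(** An element fixed by theta is determined by its upper row, with entries d and
o here, and the upper row of a bracket depends only on the upper rows and their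
images under t |-> t^-1. The relations are then identities between s, t, t'
that hold in any commutative algebra where t t' = 1 and s = (t + t')/2. *)
Lemma calO_rel_of_entries :
    2 != 0 :> F -> t * t' = 1 -> s = 2^-1 *: (t + t') ->
    (forall u w, d u = d w -> o u = o w -> u = w) ->
    (forall g, d (v g) = dg g) -> (forall g, o (v g) = og g) ->
    (forall g h, d [lie v g, v h] = og g * og' h - og h * og' g) ->
    (forall g h, o [lie v g, v h] =
       (dg g - dg' g) * og h - (dg h - dg' h) * og g) ->
  forall x y, calO_rel x y -> lie_eval v x = lie_eval v y.
Proof.
move=> two_neq0 tt sE inj dv ov dB oB x y.
have [h h2 hE] : exists2 h : R, 2 * h = 1 & forall z : R, 2^-1 *: z = h * z.
  exists (2^-1)%:A => [|z]; last by rewrite mulr_algl.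
  by rewrite mulr_natl -scaler_nat scalerA mulfV ?scale1r.
have fE (z : R) : (4 : F) *: z = 4 * z by rewrite scaler_nat mulr_natl.
have t'E : t' = s * 2 - t.
  by rewrite mulr_natr sE -scaler_nat scalerA mulfV // scale1r addrC addKr.
(* With t' eliminated, t t' = 1 becomes a rewrite rule for the monomial t^2. *)
have t2 : t * t = s * t * 2 - 1.
  by transitivity (s * t * 2 - t * t'); [rewrite t'E; ring | rewrite tt].
have dD := linearD d; have dN := linearN d; have dZ := linearZ_LR d.
have oD := linearD o; have oN := linearN o; have oZ := linearZ_LR o.
have d0 := linear0 d; have o0 := linear0 o.
case=> [k|k|k|k|k|k|k l|k l|k l|k l|k l|k l|k l|k l|k l|k l]; apply: inj => /=.
all: rewrite ?(dD, oD) ?(dZ, oZ) ?(dD, oD) ?(dN, oN) ?(dZ, oZ) ?(d0, o0).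
all: rewrite ?dB ?oB ?dv ?ov ?hE ?fE /gen_diag /gen_off ?exprS ?expr0.
(* Goals 1 and 3 are the diagonal entries of [A_0, B_k] and [A_k, B_0], the only
ones where the factor h = 1/2 survives; multiplying by 2 h = 1 on the left makes
them polynomial identities. *)
1,3: by rewrite -[LHS]mul1r -[X in X * _ = _]h2; ring.
all: rewrite ?t'E; ring: t2.
Qed.

End AbstractRelations.

Section LoopSide.
Context (F : fieldType) (charF0 : [pchar F] =i pred0).
Local Notation t := (tpos F).
Local Notation t' := (tneg F).
Local Notation s := (tav F).
Local Notation ev := (horner_alg s).
Implicit Types u w : calO F.

Definition diag_entry u : laurent F := calO_val u 0 0.
Definition off_entry u : laurent F := calO_val u 0 1.

Lemma diag_entry_linear : linear diag_entry.
Proof. by move=> c u w; rewrite /diag_entry -loopZE -loopDE. Qed.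
Lemma off_entry_linear : linear off_entry.
Proof. by move=> c u w; rewrite /off_entry -loopZE -loopDE. Qed.
HB.instance Definition _ :=
  GRing.isLinear.Build F (calO F) (laurent F) *:%R diag_entry diag_entry_linear.
HB.instance Definition _ :=
  GRing.isLinear.Build F (calO F) (laurent F) *:%R off_entry off_entry_linear.

Lemma calO_entriesE u :
  calO_val u 1 0 = linv (off_entry u) /\ calO_val u 1 1 = linv (diag_entry u).
Proof.
have /calO_predP[_ e] := valP u; rewrite /off_entry /diag_entry.
by rewrite -{1 3}[calO_val u]e !mxE.
Qed.

(** Invariance under theta makes the upper row determine the lower one. *)
Lemma calO_eqP u w :
  diag_entry u = diag_entry w -> off_entry u = off_entry w -> u = w.
Proof.
move=> ed eo; apply/val_inj/loop_eqP => //=.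
  by rewrite !(calO_entriesE _).1 eo.
by rewrite !(calO_entriesE _).2 ed.
Qed.

(** The two diagonal entries are exchanged by t |-> t^-1, so epsilon is twice
the value at 1 of either of them. *)
Lemma leval_diag u : leval 1 (diag_entry u) = 0.
Proof.
have /calO_predP[+ _] := valP u; rewrite /epsilon.
rewrite [X in _ + leval 1 X](calO_entriesE u).2 leval_linv invr1 -mulr2n.
by move/eqP;
  rewrite -mulr_natl mulf_eq0 (negPf (nat_neq0 charF0 _)) //= => /eqP.
Qed.

Lemma diag_bracket u w : diag_entry [lie u, w] =
  off_entry u * linv (off_entry w) - off_entry w * linv (off_entry u).
Proof.
rewrite /diag_entry loop_bracketE (calO_entriesE u).1 (calO_entriesE w).1.
rewrite /off_entry; ring.
Qed.

Lemma off_bracket u w : off_entry [lie u, w] =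
  (diag_entry u - linv (diag_entry u)) * off_entry w
  - (diag_entry w - linv (diag_entry w)) * off_entry u.
Proof.
rewrite /off_entry loop_bracketE (calO_entriesE u).2 (calO_entriesE w).2.
rewrite /off_entry /diag_entry; ring.
Qed.

Lemma diag_gen g : diag_entry (gen_calO F g) = gen_diag s t t' g.
Proof. by case: g => k; rewrite /diag_entry /= !mxE //= mulr0. Qed.

Lemma off_gen g : off_entry (gen_calO F g) = gen_off s t g.
Proof. by case: g => k; rewrite /off_entry /= !mxE //= ?mulr0 ?mulr1. Qed.

Lemma linv_gen_diag g : linv (gen_diag s t t' g) = gen_diag s t' t g.
Proof.
case: g => k;
  rewrite ?linv0 // linvM rmorphXn /= linv_tav linvD linvN rmorph_nat;
  by rewrite rmorphMn /= ?linv_tpos ?linv_tneg.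
Qed.

Lemma linv_gen_off g : linv (gen_off s t g) = gen_off s t' g.
Proof.
by case: g => k; rewrite ?linv0 // ?linvM rmorphXn /= linv_tav ?linv_tpos.
Qed.

Lemma gen_calO_rel x y : calO_rel x y ->
  lie_eval (gen_calO F) x = lie_eval (gen_calO F) y.
Proof.
apply: (calO_rel_of_entries (nat_neq0 charF0 _) (tposV F) erefl calO_eqP
  diag_gen off_gen) => // g h.
  by rewrite [LHS]diag_bracket !off_gen !linv_gen_off.
by rewrite [LHS]off_bracket !off_gen !diag_gen !linv_gen_diag.
Qed.

(** * The basis of the loop subalgebra *)

Local Notation OD := (Gdiff (gen_calO F)).
Local Notation OE := (Gsum (gen_calO F)).

Lemma off_Gdiff k : off_entry (OD k) = 0.
Proof. by rewrite linearZ linearB /= !off_gen subrr scaler0. Qed.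

Lemma off_Gsum k : off_entry (OE k) = 0.
Proof. by rewrite linearD /= !off_gen addr0. Qed.

Lemma diag_Gdiff k : diag_entry (OD k) = s ^+ k * (t' - t).
Proof.
rewrite linearZ linearB /= !diag_gen /gen_diag -mulrBr scalerAr; congr (_ * _).
rewrite opprB addrA subrK -mulrnBl -scaler_nat scalerA mulVf ?scale1r //.
exact: nat_neq0.
Qed.

Lemma diag_Gsum k : diag_entry (OE k) = s ^+ k * ((s - 1) *+ 4).
Proof.
rewrite linearD /= !diag_gen /gen_diag -mulrDr; congr (_ * _).
rewrite addrACA -mulrnDl -(tav2 charF0); ring.
Qed.

Lemma off_basis_comb p q r e :
  off_entry (basis_comb (gen_calO F) p q r e) = ev p + ev q * t.
Proof.
rewrite [LHS](linear_basis_comb (a := fun k => s ^+ k) (b := fun k => s ^+ k * t)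
  (d := fun k => 0) (e := fun k => 0)
  (fun k => off_gen (Wneg k)) (fun k => off_gen (Wpos k)) off_Gdiff off_Gsum).
by rewrite pcomb_exp pcomb_mul (pcomb0 _ r) (pcomb0 _ e) !addr0.
Qed.

(** The right-hand side uses t^-1 - t = 2 s - 2 t to expand the entry over the
basis 1, t of the Laurent polynomials over F[s]. *)
Lemma diag_basis_comb p q r e :
  diag_entry (basis_comb (gen_calO F) p q r e) =
  ev (r * 'X *+ 2 + e * ('X - 1) *+ 4) + ev (- r *+ 2) * t.
Proof.
rewrite [LHS](linear_basis_comb (a := fun k => 0) (b := fun k => 0)
  (d := fun k => s ^+ k * (t' - t)) (e := fun k => s ^+ k * ((s - 1) *+ 4))
  (fun k => diag_gen (Wneg k)) (fun k => diag_gen (Wpos k)) diag_Gdiff diag_Gsum).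
rewrite (pcomb0 _ p) (pcomb0 _ q) !add0r !pcomb_mul.
have -> : t' - t = s *+ 2 - t *+ 2.
  by rewrite (tav2 charF0) mulr2n opprD addrA [t + t']addrC addrK.
have -> : ev (r * 'X *+ 2 + e * ('X - 1) *+ 4) = ev r * s *+ 2 + ev e * (s - 1) *+ 4.
  by rewrite rmorphD !rmorphMn !rmorphM rmorphB /= horner_algX rmorph1.
have -> : ev (- r *+ 2) = - ev r *+ 2 by rewrite rmorphMn rmorphN.
move: (ev r) (ev e) => /= x y; ring.
Qed.

Lemma basis_comb_eq0 p q r e :
  basis_comb (gen_calO F) p q r e = 0 -> [/\ p = 0, q = 0, r = 0 & e = 0].
Proof.
move=> c0; have := off_basis_comb p q r e; have := diag_basis_comb p q r e.
rewrite c0 !linear0 => /esym/(laurent_indep charF0)[re0 r0].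
move=> /esym/(laurent_indep charF0)[-> ->].
have r_eq0 : r = 0.
  apply/eqP; move/eqP: r0; rewrite mulNrn oppr_eq0 -scaler_nat scaler_eq0.
  by rewrite (negPf (nat_neq0 charF0 _)).
split=> //; apply/eqP; move/eqP: re0; rewrite r_eq0 mul0r mul0rn add0r.
rewrite -scaler_nat scaler_eq0 (negPf (nat_neq0 charF0 _)) //= mulf_eq0.
by rewrite -[1]/(1%:P) polyXsubC_eq0 orbF.
Qed.

(** If the diagonal entry is a(s) + b(s) t, the D-part has to be -b/2 and the
E-part has to solve 4 (X - 1) e = a + b X; this is possible because the entry
vanishes at t = 1, where s = 1 as well. *)
Lemma basis_comb_surj u : exists p q r e, u = basis_comb (gen_calO F) p q r e.
Proof.
have [p [q pq]] := laurent_span charF0 (off_entry u).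
have [a [b ab]] := laurent_span charF0 (diag_entry u).
have root1 : root (a + b * 'X) 1.
  have := leval_diag u; rewrite ab levalD levalM ?oner_eq0 //.
  rewrite (leval_ev a) ?oner_eq0 // (leval_ev b) ?oner_eq0 // leval_mono invr1 expr1z !mulr1.
  rewrite mulVf ?nat_neq0 // => e; apply/rootP.
  by rewrite hornerD hornerM hornerX mulr1.
have [e eE] := factor_theorem _ _ root1.
have [r r2] : exists r : {poly F}, r *+ 2 = - b.
  exists (- ((2^-1 : F) *: b)).
  by rewrite mulNrn -scaler_nat scalerA mulfV ?scale1r ?nat_neq0.
have pa : r * 'X *+ 2 + (4^-1 *: e) * ('X - 1) *+ 4 = a.
  rewrite -mulrnAl r2 -[_ *+ 4]mulrnAl -scaler_nat scalerA mulfV ?nat_neq0 //.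
  by rewrite scale1r -eE mulNr addrC addrK.
have pb : - r *+ 2 = b by rewrite mulNrn r2 opprK.
exists p, q, r, (4^-1 *: e); apply: calO_eqP.
  by have := diag_basis_comb p q r (4^-1 *: e); rewrite pa pb -ab => ->.
by have := off_basis_comb p q r (4^-1 *: e); rewrite -pq => ->.
Qed.

End LoopSide.

(** * The presentation *)

Theorem lemma4p24 (F : fieldType) (charF0 : [pchar F] =i pred0) :
  exists f : presented (@calO_rel F) -> calO F,
    [/\ lie_morphism f, bijective f &
        forall g : gen, f (pres_gen (@calO_rel F) g) = gen_calO F g].
Proof.
have [f [[f_lie f_gen] _]] := presented_universal (gen_calO_rel charF0).
pose fl : {linear presented (@calO_rel F) -> calO F} :=
  HB.pack f (GRing.isLinear.Build F _ _ *:%R f f_lie.1).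
pose v := pres_gen (@calO_rel F).
have vR x y : calO_rel x y -> lie_eval v x = lie_eval v y.
  by move=> xy; rewrite !lie_eval_pres_gen; apply/pres_piP/lc_rel.
have f_comb p q r e : f (basis_comb v p q r e) = basis_comb (gen_calO F) p q r e.
  apply: (linear_basis_comb (h := fl)) => k /=; rewrite -?f_gen //.
  - by rewrite -[f]/(fl : _ -> _) linearZ linearB /= !f_gen.
  - by rewrite -[f]/(fl : _ -> _) linearD /= !f_gen.
have f_ker u : f u = 0 -> u = 0.
  have : spanned v u.
    by rewrite -[u]pres_reprK -lie_eval_pres_gen; apply: spanned_eval.
  move=> [p [q [r [e ->]]]];
    rewrite f_comb => /(basis_comb_eq0 charF0)[-> -> -> ->].
  by rewrite /basis_comb !linear0 !addr0.
have f_inj : injective f.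
  move=> u w fuw; apply/eqP; rewrite -subr_eq0; apply/eqP/f_ker.
  by rewrite -[f]/(fl : _ -> _) linearB /= fuw subrr.
have f_surj w : exists u, f u == w.
  have [p [q [r [e ->]]]] := basis_comb_surj charF0 w.
  by exists (basis_comb v p q r e); rewrite f_comb.
exists f; split=> //.
have fK w : f (xchoose (f_surj w)) = w := eqP (xchooseP (f_surj w)).
by exists (fun w => xchoose (f_surj w)) => // u; apply: f_inj.
Qed.
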